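(* Consider the interconnected system $\dot x_i = f_i(x)+g_i(x)u_i$, $i=1,\dots,N$, with safety function $h$, safety set $\mathcal{C}=\{x: h(x)\ge 0\}$, margin $c>0$ and $\mathcal{C}_c=\{x: h(x)\ge c\}$. Suppose the system experiences multiple attack cycles $[t_{0,1},t_{f,1}],[t_{0,2},t_{f,2}],\dots$ with $t_{0,1}=t_0$, where each subsystem is compromised at most once per attack cycle. Assume $x(t_0)\in\mathcal{C}_c$ and that the nominal policy $\hat u=(\hat u_1,\dots,\hat u_N)$ satisfies the nominal-policy assumption stated in the context, with constant $\tau>0$. Let each subsystem $S_i$ employ the resilient architecture $M(S_i)$, with recovery time $t(M(S_i))$. Let $K$ be a positive integer, $\Delta=c/K$, $\mathcal{C}_j=\{x:(j-1)\Delta\le h(x)\le j\Delta\}$ for $j=1,\dots,K$, and let $\rho_{ij}<0$ be scalars such that for all $i=1,\dots,N$ and $j=1,\dots,K$ $$\frac{\partial h}{\partial x_i}(x)\, g_i(x)\,(u_i-\hat u_i(x))\ \ge\ \rho_{ij}\qquad \text{for all } x\in\mathcal{C}_j \text{ and all } u_i\in\mathcal{U}_i .$$ Let $D_i$ be the degradation function built from $\rho_{i1},\dots,\rho_{iK}$ as defined in the context, suppose each $t(M(S_i))$ lies in the domain of $D_i$, and suppose $$\sum_{i=1}^N D_i\big(t(M(S_i))\big) + c \ \ge\ 0.$$ If $t_{0,k+1}-t_{f,k}\ge\tau$ for all $k=1,2,\dots$, then the system remains safe for all time, i.e. $x(t)\in\mathcal{C}$ for all $t\ge t_0$.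
   Context: System: there are $N$ subsystems $\mathcal{S}=\{S_1,\dots,S_N\}$ with states $x_i\in\mathbb{R}^{n_i}$, $x=[x_1^T\cdots x_N^T]^T\in\mathbb{R}^n$, $n=\sum_i n_i$, and dynamics $\dot x_i=f_i(x)+g_i(x)u_i$, where $f_i:\mathbb{R}^n\to\mathbb{R}^{n_i}$ and $g_i:\mathbb{R}^n\to\mathbb{R}^{n_i\times r_i}$ are Lipschitz continuous. Inputs satisfy $u_i\in\mathcal{U}_i=\prod_{j=1}^{r_i}[\underline u_{i,j},\overline u_{i,j}]$ with $\underline u_{i,j}<\overline u_{i,j}$. Inputs are measurable functions of time and trajectories are (locally) absolutely continuous solutions of the ODE, defined for all $t\ge t_0$. The nominal control policy of $S_i$ is a map $\hat u_i=\mu_i:\mathbb{R}^n\to\mathcal{U}_i$. Safety: $h:\mathbb{R}^n\to\mathbb{R}$ is continuously differentiable; $\frac{\partial h}{\partial x_i}$ is the row vector of partial derivatives with respect to the components of $x_i$; $\mathcal{C}=\{x:h(x)\ge 0\}$. The system is safe at time $t$ if $x(t)\in\mathcal{C}$. Nominal-policy assumption: with $\alpha$ an extended class-$\mathcal{K}$ function (continuous, strictly increasing, $\alpha(0)=0$) and a constant $\tau>0$, $$\sum_{i=1}^N \frac{\partial h}{\partial x_i}\big(f_i(x)+g_i(x)\hat u_i(x)\big)\ge -\alpha(h(x)-c)\quad\forall x\in\mathcal{C}_c,$$ $$\sum_{i=1}^N \frac{\partial h}{\partial x_i}\big(f_i(x)+g_i(x)\hat u_i(x)\big)\ge \frac{c}{\tau}\quad\forall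 x\in\mathcal{C}\setminus\mathcal{C}_c.$$ Architectures and attacks: there is a finite set $\mathcal{A}=\{A_1,\dots,A_J\}$ of resilient architectures, each with a guaranteed recovery time $t(A_j)\ge 0$, and an assignment map $M:\mathcal{S}\to\mathcal{A}$. In each attack cycle $[t_{0,k},t_{f,k}]$, each subsystem $S_i$ may be compromised at most once, on a time interval contained in $[t_{0,k},t_{f,k}]$ whose length is at most $t(M(S_i))$; these intervals may have arbitrary order and overlap. While $S_i$ is compromised, $u_i(t)$ is an arbitrary corrupted input in $\mathcal{U}_i$; whenever $S_i$ is not compromised (in particular outside the attack cycles), $u_i(t)=\hat u_i(x(t))$. By time $t_{f,k}$ all subsystems compromised in the $k$-th cycle have recovered. Degradation function: let $\rho'_{i1}\le\rho'_{i2}\le\dots\le\rho'_{iK}$ be the sorted (ascending) rearrangement of $\rho_{i1},\dots,\rho_{iK}$. For $m=0,1,\dots,K$ put $\theta_{i,m}=-\Delta\sum_{j=1}^{m}\frac{1}{\rho'_{ij}}$ (so $\theta_{i,0}=0$). Then $D_i$ is the piecewise linear function $$D_i(T)=-(m-1)\Delta+\rho'_{im}\,(T-\theta_{i,m-1})\quad\text{for } \theta_{i,m-1}\le T\le\theta_{i,m},\ m=1,\dots,K,$$ where for $K\ge2$ the last interval ($m=K$) is taken as $(\theta_{i,K-1},\theta_{i,K})$, so the domain is $[0,\theta_{i,K})$; for $K=1$, $D_i(T)=\rho_{i1}T$ on $[0,-\Delta/\rho_{i1}]$. *)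

(* Defs.v *)
From HB Require Import structures.
From mathcomp Require Import all_boot all_order all_algebra.
From mathcomp Require Import all_classical all_reals all_analysis.

Set Implicit Arguments.
Unset Strict Implicit.
Unset Printing Implicit Defensive.

Import Order.TTheory GRing.Theory Num.Theory.
Import numFieldNormedType.Exports.

Local Open Scope classical_set_scope.
Local Open Scope ring_scope.

(* The global state is the stacked column x : 'cV_(\sum_i n_ i), and x_i is
   [submxcol x i]; the a-th component of x_i is entry [tagnat.Rank i a] of x. *)
Definition block_grad (R : realType) (N : nat) (n_ : 'I_N -> nat)
    (h : 'cV[R]_(\sum_i n_ i) -> R) (i : 'I_N) (x : 'cV[R]_(\sum_i n_ i)) :
    'rV[R]_(n_ i) :=
  \row_(a < n_ i) 'D_(delta_mx (tagnat.Rank i a) 0) h x.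

Definition continuously_differentiable (R : realType) (N : nat)
    (n_ : 'I_N -> nat) (h : 'cV[R]_(\sum_i n_ i) -> R) : Prop :=
  (forall x, differentiable h x) /\ (forall i, continuous (block_grad h i)).

Definition superlevel (R : realType) (T : Type) (h : T -> R) (c : R) : set T :=
  [set x | c <= h x].

Definition input_box (R : realType) (r : nat) (lo hi : 'cV[R]_r) :
    set 'cV[R]_r :=
  [set v | forall j, lo j 0 <= v j 0 <= hi j 0].

Definition extended_class_K (R : realType) (alpha : R -> R) : Prop :=
  [/\ continuous alpha, {homo alpha : s t / s < t} & alpha 0 = 0].

Definition nominal_hdot (R : realType) (N : nat) (n_ r_ : 'I_N -> nat)
    (h : 'cV[R]_(\sum_i n_ i) -> R)
    (f : forall i, 'cV[R]_(\sum_i n_ i) -> 'cV[R]_(n_ i))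
    (g : forall i, 'cV[R]_(\sum_i n_ i) -> 'M[R]_(n_ i, r_ i))
    (uhat : forall i, 'cV[R]_(\sum_i n_ i) -> 'cV[R]_(r_ i))
    (x : 'cV[R]_(\sum_i n_ i)) : R :=
  \sum_(i < N) (block_grad h i x *m (f i x + g i x *m uhat i x)) 0 0.

Definition nominal_policy_assumption (R : realType) (N : nat)
    (n_ r_ : 'I_N -> nat)
    (h : 'cV[R]_(\sum_i n_ i) -> R)
    (f : forall i, 'cV[R]_(\sum_i n_ i) -> 'cV[R]_(n_ i))
    (g : forall i, 'cV[R]_(\sum_i n_ i) -> 'M[R]_(n_ i, r_ i))
    (uhat : forall i, 'cV[R]_(\sum_i n_ i) -> 'cV[R]_(r_ i))
    (alpha : R -> R) (c tau : R) : Prop :=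
  (forall x, superlevel h c x ->
     - alpha (h x - c) <= nominal_hdot h f g uhat x) /\
  (forall x, (superlevel h 0 `\` superlevel h c) x ->
     c / tau <= nominal_hdot h f g uhat x).

Definition absolutely_continuous_on (R : realType) (V : normedModType R)
    (a b : R) (F : R -> V) : Prop :=
  forall e : R, 0 < e -> exists2 d : R, 0 < d &
    forall s : seq (R * R),
      all (fun p => (a <= p.1) && (p.1 <= p.2) && (p.2 <= b)) s ->
      pairwise (fun p q => (p.2 <= q.1) || (q.2 <= p.1)) s ->
      \sum_(p <- s) (p.2 - p.1) < d ->
      \sum_(p <- s) `|F p.2 - F p.1| < e.

(* Lebesgue (rather than Borel) measurability: preimages of Borel sets belong
   to the domain of [completed_lebesgue_measure]. *)
Definition lebesgue_measurable_fun (R : realType) (D : set R) (F : R -> R) :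
    Prop :=
  @measurable_fun _ _ (caratheodory_type (@wlength R idfun)^*%mu) R D F.

Definition admissible_input (R : realType) (N : nat) (r_ : 'I_N -> nat)
    (lo hi : forall i, 'cV[R]_(r_ i)) (t0 : R)
    (u : forall i, R -> 'cV[R]_(r_ i)) : Prop :=
  (forall i j, lebesgue_measurable_fun `[t0, +oo[ (fun t => u i t j 0)) /\
  (forall i t, t0 <= t -> input_box (lo i) (hi i) (u i t)).

Definition trajectory (R : realType) (N : nat) (n_ r_ : 'I_N -> nat)
    (f : forall i, 'cV[R]_(\sum_i n_ i) -> 'cV[R]_(n_ i))
    (g : forall i, 'cV[R]_(\sum_i n_ i) -> 'M[R]_(n_ i, r_ i))
    (u : forall i, R -> 'cV[R]_(r_ i)) (t0 : R)
    (x : R -> 'cV[R]_(\sum_i n_ i)) : Prop :=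
  (forall b, t0 <= b -> absolutely_continuous_on t0 b x) /\
  (forall i, {ae (@lebesgue_measure R), forall t, t0 <= t ->
     is_derive t 1 (fun s => submxcol (x s) i)
       (f i (x t) + g i (x t) *m u i t)}).

(* The k-th attack cycle is [ts k, tf k], with k counted from 0.  A cycle in
   which no subsystem is compromised is allowed, so finitely many attack cycles
   are covered by continuing the sequence with such cycles. *)
Definition attack_cycles (R : realType) (t0 tau : R) (ts tf : nat -> R) :
    Prop :=
  [/\ ts 0%N = t0, forall k, ts k <= tf k &
      forall k, tau <= ts k.+1 - tf k].

(* [comp k i] is the time interval on which subsystem i is compromised during
   the k-th cycle; it may be empty, and any endpoints are allowed. *)
Definition compromise_intervals (R : realType) (N : nat) (trec : 'I_N -> R)
    (ts tf : nat -> R) (comp : nat -> 'I_N -> interval R) : Prop :=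
  forall k i,
    [set` comp k i] `<=` `[ts k, tf k] /\
    (lebesgue_measure [set` comp k i] <= (trec i)%:E)%E.

Definition nominal_unless_compromised (R : realType) (N : nat)
    (n_ r_ : 'I_N -> nat)
    (uhat : forall i, 'cV[R]_(\sum_i n_ i) -> 'cV[R]_(r_ i)) (t0 : R)
    (comp : nat -> 'I_N -> interval R)
    (u : forall i, R -> 'cV[R]_(r_ i))
    (x : R -> 'cV[R]_(\sum_i n_ i)) : Prop :=
  forall i t, t0 <= t -> (forall k, t \notin comp k i) ->
    u i t = uhat i (x t).

(* Layer j : 'I_K is counted from 0: j * Delta <= h <= (j + 1) * Delta. *)
Definition layer (R : realType) (T : Type) (h : T -> R) (Delta : R) (j : nat) :
    set T :=
  [set x | j%:R * Delta <= h x <= j.+1%:R * Delta].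

Definition sorted_rates (R : realType) (K : nat) (rho : 'I_K -> R) : seq R :=
  sort <=%R (codom rho).

Definition theta (R : realType) (K : nat) (Delta : R) (rho : 'I_K -> R)
    (m : nat) : R :=
  - Delta * \sum_(j < m) ((sorted_rates rho)`_j)^-1.

(* Indices are counted from 0, so that the piece number m (m < K) is the one
   on [theta m, theta m.+1]; see [degradationE]. *)
Definition degradation (R : realType) (K : nat) (Delta : R) (rho : 'I_K -> R)
    (T : R) : R :=
  let m := find (fun m => T <= theta Delta rho m.+1) (iota 0 K) in
  - m%:R * Delta + (sorted_rates rho)`_m * (T - theta Delta rho m).

Definition degradation_domain (R : realType) (K : nat) (Delta : R)
    (rho : 'I_K -> R) : set R :=
  if K == 1%N then `[0, theta Delta rho K]%classic
  else `[0, theta Delta rho K[%classic.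

Lemma sorted_rates_lt0 (R : realType) (K : nat) (rho : 'I_K -> R) (m : nat) :
  (forall j, rho j < 0) -> (m < K)%N -> (sorted_rates rho)`_m < 0.
Proof.
move=> rho0 mK.
have : (sorted_rates rho)`_m \in codom rho.
  by rewrite -(mem_sort <=%R) mem_nth// size_sort size_codom card_ord.
by case/codomP => j ->.
Qed.

Lemma thetaS (R : realType) (K : nat) (Delta : R) (rho : 'I_K -> R) (m : nat) :
  theta Delta rho m.+1 = theta Delta rho m - Delta / (sorted_rates rho)`_m.
Proof. by rewrite /theta big_ord_recr/= mulrDr !mulNr. Qed.

Lemma theta_lt (R : realType) (K : nat) (Delta : R) (rho : 'I_K -> R)
    (m p : nat) :
  0 < Delta -> (forall j, rho j < 0) -> (m < p)%N -> (p <= K)%N ->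
  theta Delta rho m < theta Delta rho p.
Proof.
move=> D0 rho0; elim: p => // p IH; rewrite ltnS => mp pK.
have step : theta Delta rho p < theta Delta rho p.+1.
  by rewrite thetaS ltrDl oppr_gt0 pmulr_rlt0// invr_lt0 sorted_rates_lt0.
move: mp; rewrite leq_eqVlt => /predU1P[->//|mp].
exact: lt_trans (IH mp (ltnW pK)) step.
Qed.

Lemma degradationE (R : realType) (K : nat) (Delta : R) (rho : 'I_K -> R)
    (m : nat) (T : R) :
  0 < Delta -> (forall j, rho j < 0) -> (m < K)%N ->
  theta Delta rho m <= T <= theta Delta rho m.+1 ->
  degradation Delta rho T =
    - m%:R * Delta + (sorted_rates rho)`_m * (T - theta Delta rho m).
Proof.
move=> D0 rho0 mK /andP[Tm TM]; rewrite /degradation.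
set P := fun m => _; set q := find _ _.
have hP : has P (iota 0 K).
  by apply/hasP; exists m; rewrite ?mem_iota.
have qK : (q < K)%N by move: hP; rewrite has_find size_iota.
have Pq : T <= theta Delta rho q.+1.
  by have := nth_find 0%N hP; rewrite nth_iota.
have qm : (q <= m)%N.
  rewrite leqNgt; apply/negP => /(before_find 0%N).
  by rewrite nth_iota// add0n /P TM.
move: qm; rewrite leq_eqVlt => /predU1P[->//|qm].
have TE : T = theta Delta rho q.+1.
  apply/eqP; rewrite eq_le Pq /=; apply: le_trans Tm.
  move: qm; rewrite leq_eqVlt => /predU1P[->//|qm].
  exact: ltW (theta_lt D0 rho0 qm (ltnW mK)).
have mE : m = q.+1.
  apply/eqP; rewrite eqn_leq qm andbT leqNgt; apply/negP => qm1.
  by move: Tm; rewrite TE leNgt (theta_lt D0 rho0 qm1 (ltnW mK)).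
have sq := lt_eqF (sorted_rates_lt0 rho0 qK).
rewrite TE mE subrr mulr0 addr0 thetaS addrAC subrr add0r mulrN.
by rewrite mulrCA divff ?sq// mulr1 -natr1 !mulNr mulrDl mul1r opprD.
Qed.

(* Main.v *)
(* Only the margin 0 <= h < c matters.  By linear programming duality,
   - D_i(T_i) = lam_i T_i + Delta \sum_j (1 - mu_ij), where lam_i is minus the
   slope of D_i at T_i and mu_ij = min(1, lam_i / |rho_ij|).  Put
   kappa_j = \prod_i mu_ij and let W be the increasing piecewise linear function
   with slope kappa_j on layer j and W(0) = 0.  Since kappa_j |rho_ij| <= lam_i,
   while h <= c the attack on subsystem i makes W(h(x(t))) decrease at rate at
   most lam_i, whatever the layer and however the attacks overlap; so, from the
   last time when h = c, W drops by at most \sum_i lam_i T_i, which the budget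
   bounds by Delta \sum_j kappa_j = W(c).  The positive term c / tau in the
   nominal rate makes the drop strictly smaller, hence h stays positive.  After
   the cycle h grows at rate c / tau until it reaches c again, and it stays above
   c until the next cycle.  Differential inequalities that hold almost everywhere
   are integrated for absolutely continuous functions by a covering argument. *)
Require Import Defs.
From HB Require Import structures.
From mathcomp Require Import all_boot all_order all_algebra.
From mathcomp Require Import all_classical all_reals all_analysis.
From mathcomp Require Import measurable_realfun ring lra.

Set Implicit Arguments.
Unset Strict Implicit.
Unset Printing Implicit Defensive.

Import Order.TTheory GRing.Theory Num.Theory.
Import numFieldNormedType.Exports.

Local Open Scope classical_set_scope.
Local Open Scope ring_scope.

(** * Differential inequalities along absolutely continuous functions *)

(* Cousin's lemma. *)
Lemma local_to_global (R : realType) (P : R -> R -> Prop) (a b : R) :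
  a <= b ->
  (forall p q r, a <= p -> p <= q -> q <= r -> r <= b ->
    P p q -> P q r -> P p r) ->
  (forall t, a <= t <= b -> exists2 d, 0 < d &
    forall r, a <= r <= b -> `|r - t| < d ->
      (r <= t -> P r t) /\ (t <= r -> P t r)) ->
  P a b.
Proof.
move=> ab Ptr Ploc.
have Prefl t : a <= t <= b -> P t t.
  move=> tab; have [d d0 /(_ t tab)] := Ploc t tab.
  by rewrite subrr normr0 => /(_ d0)[+ _]; apply.
pose S := [set t | a <= t <= b /\ P a t].
have Sa : S a by split; rewrite ?lexx//; apply: Prefl; rewrite lexx.
have Sb : has_ubound S by exists b => t [/andP[]].
have supS : has_sup S by split; [exists a|].
have am : a <= sup S by exact: ub_le_sup.
have mb : sup S <= b by apply: ge_sup; [exists a|move=> t [/andP[]]].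
have mab : a <= sup S <= b by rewrite am mb.
have [d d0 Pd] := Ploc _ mab.
have [t [tab Pat] tm] := sup_adherent d0 supS.
have t_le : t <= sup S by exact: ub_le_sup.
have Pam : P a (sup S).
  case/andP: (tab) => at_ _; apply: (Ptr a t) => //.
  apply: (Pd t tab _).1 => //; rewrite distrC ger0_norm; lra.
have [mltb|bm] := ltP (sup S) b; last by have -> : b = sup S by lra.
(* A point of [[a, b]] beyond the supremum but within the radius [d]; it would belong to [S]. *)
pose q := Num.min b (sup S + d / 2).
have mq : sup S < q by rewrite /q lt_min; apply/andP; split; lra.
have qb : q <= b by rewrite /q ge_min lexx.
have qd : q <= sup S + d / 2 by rewrite /q ge_min lexx orbT.
have : S q.
  split; first by apply/andP; split; lra.
  apply: (Ptr a (sup S)) => //; first exact: ltW.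
  apply: (Pd q _ _).2; [lra| |lra].
  by rewrite ger0_norm; lra.
by move=> /(ub_le_sup Sb); lra.
Qed.

(** Outer regularity, applied to a measurable null set [A] containing [E]: it bounds the part of [U]
    outside [A], and putting [A] back costs nothing. *)
Lemma negligible_open_cover (R : realType) (E : set R) (d : R) :
  (@lebesgue_measure R).-negligible E -> 0 < d ->
  exists U : set R, [/\ open U, E `<=` U & (lebesgue_measure U < d%:E)%E].
Proof.
move=> [A [mA A0 EA]] d0.
have [|U [oU AU UAd]] := lebesgue_regularity_outer mA _ d0.
  by apply: le_lt_trans (ltry 0); rewrite le_eqVlt; apply/orP; left; exact/eqP.
exists U; split=> //; first exact: subset_trans AU.
have mU : measurable U by exact: open_measurable.
rewrite (_ : U = (U `\` A) `|` A); last by rewrite setUC setDUK.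
apply: le_lt_trans UAd; apply: le_trans.
  by apply: measureU2 => //; exact: measurableD.
rewrite -[leRHS]adde0; apply: leeD => //.
by rewrite le_eqVlt; apply/orP; left; exact/eqP.
Qed.

(** Together with [subintervals], these are the conditions on a family in
    [absolutely_continuous_on], named so that families can be assembled piece by piece. *)
Definition nonoverlapping (R : realType) (s : seq (R * R)) :=
  pairwise (fun p q => (p.2 <= q.1) || (q.2 <= p.1)) s.

Definition subintervals (R : realType) (a b : R) (s : seq (R * R)) :=
  all (fun p => (a <= p.1) && (p.1 <= p.2) && (p.2 <= b)) s.

Lemma subintervals_widen (R : realType) (a b a' b' : R) (s : seq (R * R)) :
  a' <= a -> b <= b' -> subintervals a b s -> subintervals a' b' s.
Proof.
move=> aa bb; apply: sub_all => z /andP[/andP[az zz] zb].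
by rewrite zz (le_trans aa az) (le_trans zb bb).
Qed.

Lemma subintervals_cat (R : realType) (p q r : R) (s1 s2 : seq (R * R)) :
  p <= q -> q <= r ->
  subintervals p q s1 -> subintervals q r s2 ->
  nonoverlapping s1 -> nonoverlapping s2 ->
  subintervals p r (s1 ++ s2) /\ nonoverlapping (s1 ++ s2).
Proof.
move=> pq qr S1 S2 D1 D2; split.
  rewrite /subintervals all_cat; apply/andP; split.
    exact: (subintervals_widen _ qr S1).
  exact: (subintervals_widen pq _ S2).
rewrite /nonoverlapping pairwise_cat; apply/and3P; split=> //.
apply/allrelP => z w /(allP S1)/andP[_ zq] /(allP S2)/andP[/andP[qw _] _].
by rewrite (le_trans zq qw).
Qed.

(* The increment is controlled by a rate on the points off [U], and by the
   variation over a family of intervals of total length at most |U| around the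
   points of [U]; both controls are additive, so that [local_to_global]
   applies. *)
Lemma increment_control (R : realType) (a b e : R) (F : R -> R) (U : set R) :
  a <= b -> 0 <= e -> open U ->
  (forall t, a <= t <= b -> ~ U t -> exists2 d, 0 < d &
    forall r, a <= r <= b -> `|r - t| < d ->
      - e * (r - t) ^+ 2 <= (F r - F t) * (r - t)) ->
  exists s : seq (R * R), [/\ subintervals a b s, nonoverlapping s,
    ((\sum_(p <- s) (p.2 - p.1))%:E <= lebesgue_measure U)%E &
    F a - F b <= e * (b - a) + \sum_(p <- s) `|F p.2 - F p.1|].
Proof.
move=> ab e0 oU FU.
have mU : measurable U by exact: open_measurable.
(* Half-open intervals make the portions of [U] met by adjacent pieces disjoint, so that the measure
   bounds add up. *)
pose P p q := exists s : seq (R * R), [/\ subintervals p q s, nonoverlapping s,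
    ((\sum_(z <- s) (z.2 - z.1))%:E
      <= lebesgue_measure (U `&` `]p, q]%classic))%E &
    F p - F q <= e * (q - p) + \sum_(z <- s) `|F z.2 - F z.1|].
suff: P a b.
  move=> [s [s1 s2 s3 s4]]; exists s; split=> //; apply: le_trans s3 _.
  by apply: le_measure; rewrite ?inE//; exact: measurableI.
apply: local_to_global => //.
- move=> p q r ap pq qr rb [s1 [S1 D1 L1 V1]] [s2 [S2 D2 L2 V2]].
  exists (s1 ++ s2).
  have [-> ->] := subintervals_cat pq qr S1 S2 D1 D2.
  rewrite !big_cat/=; split=> //; last by lra.
  have -> : U `&` `]p, r]%classic
      = (U `&` `]p, q]%classic) `|` (U `&` `]q, r]%classic).
    rewrite -setIUr; congr (_ `&` _); apply/seteqP; split=> z /=;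
      rewrite !in_itv/=.
      by case: (leP z q) => zq /andP[pz zr]; [left|right]; apply/andP; split.
    by case=> /andP[z1 z2]; apply/andP; split; lra.
  rewrite measureU; [by rewrite EFinD; exact: leeD| | |].
  + exact: measurableI.
  + exact: measurableI.
  + apply/seteqP; split=> z //=; rewrite !in_itv/= => -[[_ /andP[_ zq]]].
    by move=> [_ /andP[qz _]]; lra.
(* Off [U] the rate bound suffices, with the empty family. Around a point of [U] a whole ball lies
   in [U], and the single interval [(p, q)] serves: its length is the measure of [U] inside it, and
   its own variation bounds the increment. *)
- move=> t tab; have [Ut|nUt] := pselect (U t); last first.
    have [d d0 Fd] := FU t tab nUt; exists d => // r rab rt.
    have {}Fd := Fd r rab rt.
    split=> [rle|ler]; exists [::]; rewrite !big_nil addr0; split=> //.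
      by move: rle; rewrite le_eqVlt => /predU1P[->|rlt]; nra.
    by move: ler; rewrite le_eqVlt => /predU1P[->|rlt]; nra.
  have /nbhs_ballP[d /= d0 dU] : nbhs t U by exact: open_nbhs_nbhs.
  exists d => // r rab rt.
  have key p q : p <= q -> `|p - t| < d -> `|q - t| < d -> P p q.
    move=> pq pt qt; exists [:: (p, q)]; rewrite !big_seq1/=; split=> //.
    - by rewrite /subintervals/= !lexx pq.
    - have -> : U `&` `]p, q]%classic = `]p, q]%classic.
        apply: setIidr => z /=; rewrite in_itv/= => /andP[pz zq]; apply: dU.
        by move: pt qt; rewrite /ball/= !ltr_norml => /andP[? ?] /andP[? ?];
          apply/andP; split; lra.
      rewrite lebesgue_measure_itv/= lte_fin; case: ltP => [|qp] //.
      by rewrite lee_fin; lra.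
    - have := ler_norm (F p - F q); rewrite distrC => /le_trans; apply.
      by rewrite lerDr mulr_ge0// subr_ge0.
  have tt : `|t - t| < d by rewrite subrr normr0.
  by split=> ?; exact: key.
Qed.

(** [E] is covered by an open set so small that absolute continuity makes the variation over the
    covering intervals negligible; elsewhere the rate bound limits the loss. That bound says that
    difference quotients are at least [- e]; multiplied by [(r - t) ^+ 2], it treats both sides of
    [t] alike. *)
Lemma absolutely_continuous_nondecreasing (R : realType) (a b : R) (F : R -> R)
    (E : set R) :
  a <= b -> absolutely_continuous_on a b F ->
  (@lebesgue_measure R).-negligible E ->
  (forall t, a <= t <= b -> ~ E t -> forall e, 0 < e -> exists2 d, 0 < d &
    forall r, a <= r <= b -> `|r - t| < d ->
      - e * (r - t) ^+ 2 <= (F r - F t) * (r - t)) ->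
  F a <= F b.
Proof.
move=> ab acF E0 FE; apply/ler_addgt0Pr => e e0.
(* Chosen so that the loss off the cover, [e' * (b - a)], and the variation over it, [e'], add up to
   [e]. *)
pose e' := e / (b - a + 1).
have D0 : 0 < b - a + 1 by lra.
have e'0 : 0 < e' by rewrite divr_gt0.
have [d d0 Fd] := acF _ e'0.
have [U [oU EU Ud]] := negligible_open_cover E0 d0.
have [|s [s1 s2 s3 s4]] := increment_control (F := F) ab (ltW e'0) oU.
  by move=> t tab nUt; apply: FE => // /EU.
have {}s3 : \sum_(p <- s) (p.2 - p.1) < d.
  by rewrite -lte_fin; exact: le_lt_trans Ud.
have := Fd s s1 s2 s3.
have -> : e = e' * (b - a) + e' by rewrite /e'; field; apply: lt0r_neq0.
by move: s4; lra.
Qed.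

Lemma absolutely_continuous_on_sub (R : realType) (V : normedModType R)
    (a b p q : R) (X : R -> V) :
  a <= p -> q <= b ->
  absolutely_continuous_on a b X -> absolutely_continuous_on p q X.
Proof.
move=> ap qb acX e /acX[d d0 Xd]; exists d => // s s1.
by apply: Xd; exact: (subintervals_widen ap qb s1).
Qed.

(** The term in [r - s] lets [F] depend on time directly as well as through [X], as the comparison
    functions below do. *)
Definition lipschitz_along (R : realType) (V : normedModType R) (X : R -> V)
    (F : R -> R) (L : R) (D : set R) :=
  forall r s, D r -> D s -> `|F r - F s| <= L * (`|X r - X s| + `|r - s|).

Lemma lipschitz_along_absolutely_continuous (R : realType)
    (V : normedModType R) (a b L : R) (X : R -> V) (F : R -> R) :
  absolutely_continuous_on a b X -> 0 <= L ->
  lipschitz_along X F L `[a, b] ->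
  absolutely_continuous_on a b F.
Proof.
move=> acX L0 FL e e0.
have M0 : 0 < L + 1 by lra.
(* One half is for the variation of [X], the other for the total length; [L + 1] avoids a division
   by 0. *)
have e'0 : 0 < e / (L + 1) / 2 by rewrite !divr_gt0.
have [d d0 Xd] := acX _ e'0.
exists (Num.min d (e / (L + 1) / 2)); first by rewrite lt_min d0.
move=> s s1 s2; rewrite lt_min => /andP[/(Xd s s1 s2) VX Vt].
apply: (@le_lt_trans _ _ (L * (\sum_(p <- s) `|X p.2 - X p.1|
    + \sum_(p <- s) (p.2 - p.1)))).
  rewrite -big_split mulr_sumr/= big_seq [leRHS]big_seq; apply: ler_sum => z.
  move=> /(allP s1)/andP[/andP[az zz] zb].
  rewrite -[in leRHS](@ger0_norm _ (z.2 - z.1)) ?subr_ge0//.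
  by apply: FL; rewrite /= in_itv/=; apply/andP; split; lra.
have ee : e = (L + 1) * (e / (L + 1) / 2 + e / (L + 1) / 2).
  by field; exact: lt0r_neq0.
by rewrite [ltRHS]ee; nra.
Qed.

(** Lipschitz constants of [F] are only available locally, so monotonicity is proved on short
    intervals, where [F] inherits absolute continuity from [X], and then glued by
    [local_to_global]. *)
Lemma nondecreasing_along (R : realType) (V : normedModType R)
    (a b : R) (X : R -> V) (F : R -> R) (E : set R) :
  a <= b -> absolutely_continuous_on a b X ->
  (@lebesgue_measure R).-negligible E ->
  (forall t, a <= t <= b -> exists d L, [/\ 0 < d, 0 <= L &
    lipschitz_along X F L (`[a, b] `&` ball t d)]) ->
  (forall t, a <= t <= b -> ~ E t -> forall e, 0 < e -> exists2 d, 0 < d &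
    forall r, a <= r <= b -> `|r - t| < d ->
      - e * (r - t) ^+ 2 <= (F r - F t) * (r - t)) ->
  F a <= F b.
Proof.
move=> ab acX E0 Floc FE.
apply: (local_to_global (P := fun p q => F p <= F q)) => //.
  by move=> p q r _ _ _ _; exact: le_trans.
move=> t tab; have [d [L [d0 L0 FL]]] := Floc t tab.
exists d => // r rab rt.
have key p q : a <= p -> p <= q -> q <= b -> `|p - t| < d -> `|q - t| < d ->
    F p <= F q.
  move=> ap pq qb pt qt.
  apply: (@absolutely_continuous_nondecreasing _ p q F E) => //.
    apply: (lipschitz_along_absolutely_continuous _ L0).
      exact: absolutely_continuous_on_sub acX.
    move: pt qt; rewrite !ltr_norml => /andP[? ?] /andP[? ?].
    by move=> v w /=; rewrite !in_itv/= => /andP[? ?] /andP[? ?];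
      apply: FL; split; rewrite /ball/= ?in_itv/= ?ltr_norml;
      apply/andP; split; lra.
  move=> v /andP[pv vq] nEv e e0.
  have vab : a <= v <= b by apply/andP; split; lra.
  have [d' d'0 Fd'] := FE v vab nEv e e0.
  exists d' => // w /andP[pw wq]; apply: Fd'.
  by apply/andP; split; lra.
move: tab rab => /andP[? ?] /andP[? ?].
by split=> ?; apply: key => //; rewrite subrr normr0.
Qed.

(** * Continuously differentiable functions of the stacked state *)

Lemma continuous_coordE (R : realType) (T : topologicalType) (n : nat)
    (F : T -> 'rV[R]_n) (j : 'I_n) :
  continuous F -> continuous (fun z => F z 0 j).
Proof.
move=> cF z; apply: (@continuous_comp _ _ _ F (fun A => A 0 j)).
  exact: cF.
exact: coord_continuous.
Qed.

Section gradient.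
Context (R : realType) (N : nat) (n_ : 'I_N -> nat).
Context (h : 'cV[R]_(\sum_i n_ i) -> R).

Lemma diff_block_grad z v : differentiable h z ->
  'd h z v = \sum_(i < N) (block_grad h i z *m submxcol v i) 0 0.
Proof.
move=> dh; rewrite -summxE -mul_mxrow_mxcol submxcolK.
rewrite [in LHS](matrix_sum_delta v) linear_sum/= mxE; apply: eq_bigr => k _.
rewrite big_ord1 linearZ/= mulrC; congr (_ * _).
by rewrite !mxE tagnat.sig2K deriveE.
Qed.

Lemma partial_continuous : (forall i, continuous (block_grad h i)) ->
  forall k, continuous (fun z => 'D_(delta_mx k 0) h z).
Proof.
move=> ch k.
have -> : (fun z => 'D_(delta_mx k 0) h z)
    = fun z => block_grad h (tagnat.sig1 k) z 0 (tagnat.sig2 k).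
  by apply/funext => z; rewrite mxE tagnat.sig2K.
exact: continuous_coordE.
Qed.

(** Near [p] each of the finitely many partial derivatives stays within 1 of its value at [p]; as
    the norm is the maximum norm, summing these bounds gives [L]. *)
Lemma diff_locally_bounded p : continuously_differentiable h ->
  exists d L, [/\ 0 < d, 0 <= L &
    forall z v, ball p d z -> `|'d h z v| <= L * `|v|].
Proof.
move=> [dh ch].
have /nbhs_ballP[d /= d0 hd] : \forall z \near p, forall k,
    `|'D_(delta_mx k 0) h z| <= `|'D_(delta_mx k 0) h p| + 1.
  apply: (@filter_forall _ _ (fun k z =>
    `|'D_(delta_mx k 0) h z| <= `|'D_(delta_mx k 0) h p| + 1) (nbhs p)) => k.
  have /cvgrPdist_le/(_ 1 ltr01) := partial_continuous ch (k := k) (x := p).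
  apply: filterS => z hz.
  rewrite -lerBlDl; apply: le_trans hz.
  by rewrite distrC; exact: lerB_dist.
exists d, (\sum_k (`|'D_(delta_mx k 0) h p| + 1)); split=> //.
  by apply: sumr_ge0 => k _; rewrite addr_ge0.
move=> z v /hd hz.
rewrite [in leLHS](matrix_sum_delta v) linear_sum/= mulr_suml.
apply: le_trans (ler_norm_sum _ _ _) _; apply: ler_sum => k _.
rewrite big_ord1 linearZ/= normrM mulrC; apply: ler_pM => //.
  by rewrite -deriveE.
rewrite [leRHS]/Num.norm/= mx_normrE.
exact: (le_bigmax _ (fun ij => `|v ij.1 ij.2|) (k, 0)).
Qed.

End gradient.

Lemma is_derive_diff_comp (R : realType) (V : normedModType R) (h : V -> R)
    (X : R -> V) (t : R) (v : V) :
  is_derive t 1 X v -> differentiable h (X t) ->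
  is_derive t 1 (h \o X) ('d h (X t) v).
Proof.
move=> [/derivable1_diffP dX Xv] dh.
have dhX : differentiable (h \o X) t by exact: differentiable_comp.
apply: DeriveDef; first exact/derivable1_diffP.
by rewrite deriveE// diff_comp//= -Xv deriveE.
Qed.

(** Turns a derivative into the product form that the monotonicity lemmas ask for. *)
Lemma is_derive_lower_bound (R : realType) (F : R -> R) (t D e : R) :
  is_derive t 1 F D -> 0 < e ->
  exists2 d, 0 < d & forall r, `|r - t| < d ->
    (D - e) * (r - t) ^+ 2 <= (F r - F t) * (r - t).
Proof.
move=> [dF FD] e0.
have /cvgrPdist_le/(_ e e0)/nbhs_ballP[d /= d0 hd] := dF.
exists d => // r rd.
have [->|rt] := eqVneq r t; first by rewrite !subrr expr0n !mulr0.
have rt0 : r - t != 0 by rewrite subr_eq0.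
have := hd (r - t).
rewrite /ball/= sub0r normrN => /(_ rd rt0).
rewrite -[lim _]/('D_1 F t) FD [_%:A]mulr1 subrK.
set c := _^-1 *: _; rewrite ler_norml => /andP[_ cD].
have -> : (F r - F t) * (r - t) = c * (r - t) ^+ 2.
  by rewrite /c /GRing.scale/=; field.
by rewrite ler_wpM2r ?sqr_ge0//; lra.
Qed.

Lemma is_derive_affine (R : realType) (V : normedModType R) (z v : V) (t : R) :
  is_derive t 1 (fun s : R => z + s *: v) v.
Proof.
have cv : k^-1 *: (((fun s : R => z + s *: v) \o shift t) (k *: 1)
    - (z + t *: v)) @[k --> 0^'] --> v.
  apply: cvg_near_cst; near=> k.
  have k0 : k != 0 by near: k; exact: nbhs_dnbhs_neq.
  have -> : ((fun s : R => z + s *: v) \o shift t) (k *: 1) - (z + t *: v)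
      = k *: v.
    by rewrite /= [k%:A]mulr1 scalerDl addrCA addrK.
  by rewrite scalerA mulVf// scale1r.
apply: DeriveDef; first by apply: cvgP; exact: cv.
exact: cvg_lim.
Unshelve. all: by end_near. Qed.

(** Mean value theorem along the segment from [z] to [w], which stays in the ball by convexity,
    where the differential is bounded. *)
Lemma C1_locally_lipschitz (R : realType) (N : nat) (n_ : 'I_N -> nat)
    (h : 'cV[R]_(\sum_i n_ i) -> R) p : continuously_differentiable h ->
  exists d L, [/\ 0 < d, 0 <= L &
    forall z w, ball p d z -> ball p d w -> `|h w - h z| <= L * `|w - z|].
Proof.
move=> hC1; have [d [L [d0 L0 hL]]] := diff_locally_bounded p hC1.
have [dh _] := hC1.
exists d, L; split=> // z w pz pw.
pose X (s : R) := z + s *: (w - z).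
have dhX s := is_derive_diff_comp (is_derive_affine z (w - z) s) (dh (X s)).
have [|s] := @MVT _ (h \o X) (fun s => 'd h (X s) (w - z)) 0 1 ltr01
  (fun s _ => dhX s).
  by apply: derivable_within_continuous => s _; have [] := dhX s.
rewrite in_itv/= subr0 mulr1 /X scale0r addr0 scale1r subrKC => /andP[s0 s1] ->.
apply: hL; move: pz pw; rewrite -!ball_normE/= => pz pw.
have -> : p - (z + s *: (w - z)) = (1 - s) *: (p - z) + s *: (p - w).
  rewrite opprD addrA scalerBl scale1r -[RHS]addrA; congr (_ + _).
  rewrite -scalerN opprB [RHS]addrC -scalerDr -scalerN; congr (_ *: _).
  by rewrite opprB [RHS]addrC addrA subrK.
apply: le_lt_trans (ler_normD _ _) _.
rewrite !normrZ !ger0_norm; [|lra|lra].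
nra.
Qed.

(** * Degradation functions and weighted levels *)

(** With [lam] equal to minus the slope of the piece containing [T], each layer with a steeper rate
    contributes [1 - lam / - rho j] and every other layer 0; these contributions rebuild the offset
    and the left end of the piece. *)
Lemma degradation_dual (R : realType) (K : nat) (Delta : R) (rho : 'I_K -> R)
    (T : R) :
  (0 < K)%N -> (forall j, rho j < 0) -> T <= theta Delta rho K ->
  exists2 lam : R, 0 < lam &
    - degradation Delta rho T =
      lam * T + Delta * \sum_(j < K) (1 - Num.min 1 (lam / - rho j)).
Proof.
move=> K0 rho0 TK; rewrite /degradation.
set P : pred nat := fun m => T <= _ m.+1; set m := find _ _.
(* The last piece reaches up to [theta Delta rho K], so the search succeeds and [m] is not the
   default [K]. *)
have hP : has P (iota 0 K).
  by apply/hasP; exists K.-1; rewrite ?mem_iota /= ?add0n ?/P prednK.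
have mK : (m < K)%N by move: hP; rewrite has_find size_iota.
clearbody m => {P hP}; set s := sorted_rates rho.
have sz : size s = K by rewrite /s size_sort size_codom card_ord.
have s0 j : (j < K)%N -> s`_j < 0 by exact: sorted_rates_lt0.
have smono i j : (i <= j)%N -> (j < K)%N -> s`_i <= s`_j.
  move=> ij jK; apply: (sorted_leq_nth le_trans le_refl 0) => //.
  - exact: sort_le_sorted.
  - by rewrite inE sz (leq_ltn_trans ij).
  - by rewrite inE sz.
exists (- s`_m); first by rewrite oppr_gt0 s0.
(* The sum is symmetric in the layers, so the rates may be taken in sorted order. *)
have -> : \sum_(j < K) (1 - Num.min 1 (- s`_m / - rho j)) =
    \sum_(0 <= j < K) (1 - Num.min 1 (- s`_m / - s`_j)).
  rewrite -[in RHS]sz.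
  rewrite -(big_nth 0 xpredT (fun v => 1 - Num.min 1 (- s`_m / - v))).
  rewrite (perm_big (codom rho)) ?perm_sort//=.
  by rewrite codomE big_map big_enum.
rewrite (big_cat_nat (leq0n m) (ltnW mK))/=.
(* From index [m] on the sorted rates are no steeper than the slope, so the minimum is 1; before [m]
   it is the quotient. *)
have -> : \sum_(m <= j < K) (1 - Num.min 1 (- s`_m / - s`_j)) = 0.
  rewrite big_nat; apply: big1 => j /andP[mj jK].
  have := smono _ _ mj jK; have := s0 _ jK; move=> sj0 smj.
  by rewrite min_l ?subrr// ler_pdivlMr; lra.
have -> : \sum_(0 <= j < m) (1 - Num.min 1 (- s`_m / - s`_j)) =
    \sum_(0 <= j < m) (1 - s`_m / s`_j).
  rewrite big_nat [RHS]big_nat; apply: eq_bigr => j /andP[_ jm].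
  have := smono _ _ (ltnW jm) mK; have := s0 _ (ltn_trans jm mK).
  move=> sj0 sjm.
  rewrite min_r; last by rewrite ler_pdivrMr; lra.
  by rewrite invrN mulrNN.
rewrite /theta -/s -(big_mkord xpredT (fun j => (s`_j)^-1)).
rewrite big_split/= sumrN -mulr_sumr sumr_const_nat subn0 addr0.
by rewrite -[1 *+ m]/(m%:R); ring.
Qed.

(** Up to a constant, the integral of the indicator of [[a, b]]. It serves both for layers, in
    [weighted_level], and for the durations of attacks. *)
Definition clamp (R : realType) (a b t : R) := Num.max a (Num.min b t).

Lemma clampE_in (R : realType) (a b t : R) : a <= t <= b -> clamp a b t = t.
Proof. by move=> /andP[at_ tb]; rewrite /clamp min_r// max_r. Qed.

Lemma clampE_ge (R : realType) (a b t : R) :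
  a <= b -> b <= t -> clamp a b t = b.
Proof. by move=> ab bt; rewrite /clamp min_l// max_r. Qed.

Lemma clampE_le (R : realType) (a b t : R) :
  a <= b -> t <= a -> clamp a b t = a.
Proof. by move=> ab ta; rewrite /clamp max_l// ge_min ta orbT. Qed.

Lemma clamp_bound (R : realType) (a b t : R) : a <= b -> a <= clamp a b t <= b.
Proof. by move=> ab; rewrite /clamp le_max lexx ge_max ab ge_min lexx. Qed.

Lemma clamp_homo (R : realType) (a b : R) : {homo clamp a b : s t / s <= t}.
Proof.
by move=> s t st; rewrite /clamp; apply: le_max2 => //; apply: le_min2.
Qed.

Lemma clamp_lipschitz (R : realType) (a b s t : R) : a <= b ->
  `|clamp a b s - clamp a b t| <= `|s - t|.
Proof.
move=> ab; wlog st : s t / s <= t => [H|].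
  by have [/H//|/ltW/H] := leP s t; rewrite distrC [leRHS]distrC.
rewrite distrC [leRHS]distrC !ger0_norm ?subr_ge0 ?clamp_homo//.
rewrite /clamp !minElt; case: ltP => ?; case: ltP => ?;
  by rewrite !maxElt; do ![case: ltP => ?]; lra.
Qed.

Section weighted_level.
Context (R : realType) (K : nat) (Delta : R) (kappa : 'I_K -> R).
Context (Delta0 : 0 < Delta).

(* The integral of the step function with value [kappa j] on layer [j]. *)
Definition weighted_level (z : R) :=
  \sum_(j < K) kappa j *
    (clamp (j%:R * Delta) (j.+1%:R * Delta) z - j%:R * Delta).

Let bounds (j : 'I_K) : j%:R * Delta <= j.+1%:R * Delta.
Proof. by rewrite ler_pM2r// ler_nat. Qed.

Lemma weighted_level0 : weighted_level 0 = 0.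
Proof.
apply: big1 => j _; rewrite clampE_le// ?subrr ?mulr0//.
by rewrite mulr_ge0// ltW.
Qed.

Lemma weighted_level_top : weighted_level (K%:R * Delta) =
  Delta * \sum_j kappa j.
Proof.
rewrite mulr_sumr; apply: eq_bigr => j _; rewrite clampE_ge//.
  by rewrite -natr1; ring.
by rewrite ler_pM2r// ler_nat.
Qed.

Lemma weighted_level_lipschitz y z : (forall j, 0 <= kappa j <= 1) ->
  `|weighted_level y - weighted_level z| <= K%:R * `|y - z|.
Proof.
move=> k01; rewrite /weighted_level -sumrB.
apply: le_trans (ler_norm_sum _ _ _) _.
have -> : K%:R * `|y - z| = \sum_(j < K) `|y - z|.
  by rewrite sumr_const card_ord mulr_natl.
apply: ler_sum => j _; rewrite -mulrBr opprD addrACA opprK addNr addr0.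
case/andP: (k01 j) => k0 k1; rewrite normrM ger0_norm//.
apply: le_trans (clamp_lipschitz _ _ (bounds j)).
by rewrite -[leRHS]mul1r ler_wpM2r.
Qed.

(** Only the clamp of layer [j] moves; those of the other layers are stuck at one of their ends. *)
Lemma weighted_level_layer (j : 'I_K) y z :
  j%:R * Delta <= y <= j.+1%:R * Delta ->
  j%:R * Delta <= z <= j.+1%:R * Delta ->
  weighted_level y - weighted_level z = kappa j * (y - z).
Proof.
move=> yj zj; rewrite /weighted_level -sumrB (bigD1 j)//=.
rewrite !clampE_in// big1 ?addr0; first by ring.
move=> i ij; rewrite -mulrBr; apply/eqP; rewrite mulf_eq0; apply/orP; right.
case/andP: yj => y1 y2; case/andP: zj => z1 z2.
move: ij; rewrite -val_eqE neq_ltn => /orP[ij|ji].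
  have ij' : i.+1%:R * Delta <= j%:R * Delta by rewrite ler_pM2r// ler_nat.
  by rewrite !clampE_ge ?subrr//; lra.
have ji' : j.+1%:R * Delta <= i%:R * Delta by rewrite ler_pM2r// ler_nat.
by rewrite !clampE_le ?subrr//; lra.
Qed.

Lemma layer_exists z : (0 < K)%N -> 0 <= z <= K%:R * Delta ->
  exists j : 'I_K, j%:R * Delta <= z <= j.+1%:R * Delta.
Proof.
move=> K0 /andP[z0 zK].
pose P k := z <= k.+1%:R * Delta.
have exP : exists k, P k by exists K.-1; rewrite /P prednK.
have [k Pk kmin] := ex_minnP exP.
have kK : (k < K)%N by rewrite -ltnS -(prednK K0) !ltnS kmin// /P prednK.
exists (Ordinal kK) => /=; rewrite [X in _ && X]Pk andbT.
case: k {Pk kK} kmin => [|k] kmin; first by rewrite mul0r.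
by rewrite leNgt; apply/negP => /ltW/kmin; rewrite ltnn.
Qed.

(** The layers are closed and finite in number, so those that miss [y] miss a neighbourhood of it.
    At a boundary between layers this selects the one shared with the nearby point [z]. *)
Lemma near_layer y : (0 < K)%N -> exists2 d, 0 < d &
  forall z, `|z - y| < d -> 0 <= z <= K%:R * Delta ->
  exists j : 'I_K, j%:R * Delta <= y <= j.+1%:R * Delta /\
    j%:R * Delta <= z <= j.+1%:R * Delta.
Proof.
move=> K0.
have /nbhs_ballP[d /= d0 hd] : \forall z \near y, forall j : 'I_K,
    j%:R * Delta <= z <= j.+1%:R * Delta ->
    j%:R * Delta <= y <= j.+1%:R * Delta.
  apply: (@filter_forall _ _ (fun (j : 'I_K) z =>
    j%:R * Delta <= z <= j.+1%:R * Delta ->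
    j%:R * Delta <= y <= j.+1%:R * Delta) (nbhs y)) => j.
  have [ly|ly] := ltP y (j%:R * Delta).
    near=> z => /andP[lz _]; suff: z < j%:R * Delta by lra.
    by near: z; exact: lt_nbhsl.
  have [yl|yl] := ltP (j.+1%:R * Delta) y.
    near=> z => /andP[_ zl]; suff: j.+1%:R * Delta < z by lra.
    by near: z; exact: lt_nbhsr.
  by near=> z.
exists d => // z zy /(layer_exists K0)[j zj]; exists j; split=> //.
by apply: (hd z) => //; rewrite -ball_normE/= distrC.
Unshelve. all: by end_near. Qed.

End weighted_level.

(** * Continuity and local Lipschitz bounds along a trajectory *)

Lemma absolutely_continuous_on_dist (R : realType) (V : normedModType R)
    (a b : R) (X : R -> V) (e : R) :
  absolutely_continuous_on a b X -> 0 < e -> exists2 d, 0 < d &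
    forall r t, a <= r <= b -> a <= t <= b -> `|r - t| < d ->
      `|X r - X t| < e.
Proof.
move=> acX e0; have [d d0 Xd] := acX e e0; exists d => // r t.
wlog rt : r t / t <= r => [H|].
  have [/H//|/ltW/H{}H] := leP t r => ? ?.
  by rewrite distrC [X in _ -> X < _]distrC; exact: H.
move=> /andP[ar rb] /andP[at_ tb]; rewrite ger0_norm ?subr_ge0// => rtd.
have := Xd [:: (t, r)]; rewrite /= !big_seq1/=; apply=> //.
by rewrite at_ rt rb.
Qed.

Lemma C1_lipschitz_along (R : realType) (N : nat) (n_ : 'I_N -> nat)
    (h : 'cV[R]_(\sum_i n_ i) -> R) (x : R -> 'cV[R]_(\sum_i n_ i))
    (a b t : R) :
  continuously_differentiable h -> absolutely_continuous_on a b x ->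
  a <= t <= b -> exists d L, [/\ 0 < d, 0 <= L &
    lipschitz_along x (h \o x) L (`[a, b] `&` ball t d)].
Proof.
move=> hC1 acx tab.
have [d [L [d0 L0 hL]]] := C1_locally_lipschitz (x t) hC1.
have [d' d'0 xd'] := absolutely_continuous_on_dist acx d0.
exists d', L; split=> // r s.
rewrite /= !in_itv/= -ball_normE/= => -[rab tr] [sab ts].
apply: (@le_trans _ _ (L * `|x r - x s|)); last first.
  by rewrite ler_wpM2l// lerDl.
by apply: hL; rewrite -ball_normE/=; exact: xd'.
Qed.

(** * Comparison of the safety function with the layer rates *)

(** Used to discard the endpoints of the attacks, where the clamps have kinks. *)
Lemma negligible_finite_range (R : realType) (I : finType) (P : I -> R) :
  (@lebesgue_measure R).-negligible (range P).
Proof.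
have fP : finite_set (range P) by exact: finite_image.
apply/negligibleP.
  exact/countable_measurable/finite_set_countable.
exact/countable_lebesgue_measure0/finite_set_countable.
Qed.

Section scalar_comparison.
Context (R : realType) (V : normedModType R) (X : R -> V) (y : R -> R).
Context (a b : R) (ab : a <= b) (acX : absolutely_continuous_on a b X).
Context (y_lip : forall t, a <= t <= b -> exists d L, [/\ 0 < d, 0 <= L &
    lipschitz_along X y L (`[a, b] `&` ball t d)]).

Lemma locally_lipschitz_along_dist t e : a <= t <= b -> 0 < e ->
  exists2 d, 0 < d &
    forall r, a <= r <= b -> `|r - t| < d -> `|y r - y t| < e.
Proof.
move=> tab e0; have [d1 [L [d10 L0 Hy]]] := y_lip tab.
have L10 : 0 < L + 1 by lra.
have e'0 : 0 < e / (L + 1) / 2 by rewrite !divr_gt0.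
have [d2 d20 Xd] := absolutely_continuous_on_dist acX e'0.
exists (Num.min d1 (Num.min d2 (e / (L + 1) / 2))).
  by rewrite !lt_min d10 d20.
move=> r rab; rewrite !lt_min => /and3P[r1 /(Xd _ _ rab tab) r2 r3].
apply: (@le_lt_trans _ _ (L * (`|X r - X t| + `|r - t|))).
  apply: Hy; split; rewrite /= ?in_itv// -ball_normE/= ?subrr ?normr0//.
  by rewrite distrC.
have -> : e = (L + 1) * (e / (L + 1) / 2 + e / (L + 1) / 2).
  by field; exact: lt0r_neq0.
by nra.
Qed.

(** Monotonicity of [y t - w * t]. *)
Lemma growth_of_derivative (w : R) (E : set R) :
  (@lebesgue_measure R).-negligible E ->
  (forall t, a <= t <= b -> ~ E t -> exists2 D, is_derive t 1 y D & w <= D) ->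
  y a + w * (b - a) <= y b.
Proof.
move=> E0 yE.
suff: y a - w * a <= y b - w * b by lra.
apply: (nondecreasing_along (F := fun t => y t - w * t) ab acX E0).
  move=> t /y_lip[d [L [d0 L0 Hy]]]; exists d, (L + `|w|); split=> //.
    by rewrite addr_ge0.
  move=> r s Dr Ds.
  have -> : y r - w * r - (y s - w * s) = (y r - y s) - w * (r - s) by ring.
  apply: le_trans (ler_normB _ _) _; rewrite normrM.
  rewrite mulrDl lerD//; first exact: Hy.
  by rewrite ler_wpM2l// lerDr.
move=> t tab nEt e e0; have [D yD wD] := yE t tab nEt.
have [d d0 yd] := is_derive_lower_bound yD e0.
exists d => // r _ /yd ydr.
have -> : (y r - w * r - (y t - w * t)) * (r - t) =
    (y r - y t) * (r - t) - w * (r - t) ^+ 2 by ring.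
have : 0 <= (D - w) * (r - t) ^+ 2 by rewrite mulr_ge0 ?sqr_ge0 ?subr_ge0.
by lra.
Qed.

Section attack.
Context (N K : nat) (Delta : R) (rho : 'I_N -> 'I_K -> R) (lam : 'I_N -> R).
Context (kappa : 'I_K -> R) (kappa0 w : R) (p q : 'I_N -> R).
Context (K_gt0 : (0 < K)%N) (Delta_gt0 : 0 < Delta) (w_ge0 : 0 <= w).
Context (kappa0_ge0 : 0 <= kappa0).
Context (kappa_bound : forall j, kappa0 <= kappa j <= 1).
Context (lam_ge0 : forall i, 0 <= lam i).
Context (kappa_rho : forall i j, kappa j * - rho i j <= lam i).
Context (pq : forall i, p i <= q i).
Context (y_range : forall t, a <= t <= b -> 0 <= y t <= K%:R * Delta).

(* Multiplying the rate in layer [j] by [kappa j] makes the effect of the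
   attack on subsystem [i] at most [lam i] in every layer, so that it can be
   paid for by the duration of the attack alone. *)
Lemma weighted_level_attack (E : set R) :
  (@lebesgue_measure R).-negligible E ->
  (forall t, a <= t <= b -> ~ E t -> exists2 D, is_derive t 1 y D &
    forall j : 'I_K, j%:R * Delta <= y t <= j.+1%:R * Delta ->
      w + \sum_(i < N | p i <= t <= q i) rho i j <= D) ->
  weighted_level Delta kappa (y a) + kappa0 * w * (b - a) <=
  weighted_level Delta kappa (y b) + \sum_(i < N) lam i * (q i - p i).
Proof.
move=> E0 yE.
have kappa01 j : 0 <= kappa j <= 1.
  by have /andP[k0 ->] := kappa_bound j; rewrite (le_trans kappa0_ge0 k0).
(* [C] rises at rate [lam i] while subsystem [i] is under attack, which offsets the effect of that
   attack on the weighted level. *)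
pose C t := \sum_(i < N) lam i * clamp (p i) (q i) t.
pose F t := weighted_level Delta kappa (y t) + C t - kappa0 * w * t.
suff: F a <= F b.
  have : C b - C a <= \sum_(i < N) lam i * (q i - p i).
    rewrite -sumrB; apply: ler_sum => i _; rewrite -mulrBr ler_wpM2l//.
    have /andP[? ?] := clamp_bound a (pq i).
    by have /andP[? ?] := clamp_bound b (pq i); lra.
  by rewrite /F; lra.
have E'0 : (@lebesgue_measure R).-negligible
    (E `|` range p `|` range q).
  by do ![apply: negligibleU => //]; exact: negligible_finite_range.
apply: (nondecreasing_along ab acX E'0).
  move=> t /y_lip[d [L [d0 L0 Hy]]].
  exists d, (K%:R * L + \sum_i lam i + kappa0 * w); split=> //.
    by rewrite !addr_ge0 ?mulr_ge0// sumr_ge0.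
  move=> r s Dr Ds.
  have -> : F r - F s = weighted_level Delta kappa (y r)
      - weighted_level Delta kappa (y s) + (C r - C s) - kappa0 * w * (r - s).
    by rewrite /F; ring.
  apply: le_trans (ler_normB _ _) _; rewrite mulrDl; apply: lerD; last first.
    by rewrite normrM ger0_norm ?mulr_ge0// ler_wpM2l ?mulr_ge0// lerDr.
  apply: le_trans (ler_normD _ _) _; rewrite mulrDl; apply: lerD.
    apply: le_trans (weighted_level_lipschitz Delta_gt0 _ _ kappa01) _.
    by rewrite -mulrA ler_wpM2l//; exact: Hy.
  rewrite -sumrB mulr_suml; apply: le_trans (ler_norm_sum _ _ _) _.
  apply: ler_sum => i _; rewrite -mulrBr normrM ger0_norm// ler_wpM2l//.
  by apply: le_trans (clamp_lipschitz _ _ (pq i)) _; rewrite lerDr.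
move=> t tab nE e e0.
have nEt : ~ E t by move=> Et; apply: nE; left; left.
have tp i : t != p i by apply/eqP => ?; apply: nE; left; right; exists i.
have tq i : t != q i by apply/eqP => ?; apply: nE; right; exists i.
have [D yD DE] := yE t tab nEt.
have [d1 d10 yd] := is_derive_lower_bound yD e0.
have [d2 d20 yl] := near_layer Delta (y t) K_gt0.
have [d3 d30 yd3] := locally_lipschitz_along_dist tab d20.
have : \forall r \near t, [/\ `|r - t| < d1, a <= r <= b -> `|y r - y t| < d2 &
    forall i, p i <= t <= q i -> p i <= r <= q i].
  near=> r; split.
  - near: r; apply/nbhs_ballP; exists d1 => // r.
    by rewrite -ball_normE/= distrC.
  - move=> rab; apply: yd3 => //.
  - near: r; apply: (@filter_forall _ _ (fun i r =>
      p i <= t <= q i -> p i <= r <= q i) (nbhs t)) => i.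
    have [/andP[pt tq']|nt] := boolP (p i <= t <= q i); last by near=> r.
    have {}pt : p i < t by rewrite lt_neqAle eq_sym tp.
    have {}tq' : t < q i by rewrite lt_neqAle tq.
    near=> r => _; apply/andP; split; apply/ltW; near: r.
      exact: lt_nbhsr.
    exact: lt_nbhsl.
move=> /nbhs_ballP[d /= d0 hd]; exists d => // r rab rt.
have [rt1 /(_ rab) rt2 rpq] : [/\ `|r - t| < d1,
    a <= r <= b -> `|y r - y t| < d2 &
    forall i, p i <= t <= q i -> p i <= r <= q i].
  by apply: hd; rewrite -ball_normE/= distrC.
(* A layer that contains both [y t] and [y r], so that the weighted level changes by exactly
   [kappa j] times the change of [y]. *)
have [j [tj rj]] := yl (y r) rt2 (y_range rab).
have HW := weighted_level_layer kappa Delta_gt0 rj tj.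
(* Clamps of attacked subsystems move at unit speed; the others are monotone, hence contribute
   nonnegatively. *)
have HC : (\sum_(i < N | p i <= t <= q i) lam i) * (r - t) ^+ 2 <=
    (C r - C t) * (r - t).
  rewrite -sumrB !mulr_suml [leRHS](bigID (fun i => p i <= t <= q i))/=.
  rewrite -[leLHS]addr0; apply: lerD.
    apply: ler_sum => i ti; rewrite !clampE_in//; last exact: rpq.
    by rewrite -mulrBr -mulrA expr2.
  apply: sumr_ge0 => i _; rewrite -mulrBr -mulrA mulr_ge0//.
  have [rt'|/ltW rt'] := leP t r.
    by rewrite mulr_ge0// subr_ge0// clamp_homo.
  by rewrite mulr_le0// subr_le0// clamp_homo.
have HD : kappa0 * w - \sum_(i < N | p i <= t <= q i) lam i <= kappa j * D.
  have := DE j tj; case/andP: (kappa_bound j) => k0 k1 wD.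
  apply: le_trans (ler_wpM2l (le_trans kappa0_ge0 k0) wD).
  rewrite mulrDr; apply: lerD; first exact: ler_wpM2r.
  rewrite mulr_sumr -sumrN; apply: ler_sum => i _.
  by have := kappa_rho i j; lra.
have Hy' := yd r rt1.
have -> : (F r - F t) * (r - t) = kappa j * ((y r - y t) * (r - t))
    + (C r - C t) * (r - t) - kappa0 * w * (r - t) ^+ 2.
  by rewrite mulrA -HW /F; ring.
have /andP[k0 k1] := kappa01 j.
have H1 := ler_wpM2l k0 Hy'.
have s0 : 0 <= (r - t) ^+ 2 by exact: sqr_ge0.
have H2 := ler_wpM2r s0 HD.
(* The error [e] in the derivative is scaled by [kappa j <= 1], so it stays within the tolerance. *)
have H3 : 0 <= (1 - kappa j) * (e * (r - t) ^+ 2).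
  by apply: mulr_ge0; [rewrite subr_ge0|apply: mulr_ge0 => //; exact: ltW].
by lra.
Unshelve. all: by end_near. Qed.
End attack.
End scalar_comparison.

(** * Products of weights, hulls of intervals and crossing times *)

(** The last bound is the Weierstrass product inequality; its induction step rests on
    [0 <= (1 - m i) * (1 - p)], hence the bounds on [p] carried along. *)
Lemma prod_unit_bounds (R : realType) (I : finType) (m : I -> R) :
  (forall i, 0 < m i <= 1) ->
  [/\ 0 < \prod_i m i, \prod_i m i <= 1, forall i, \prod_i m i <= m i &
    1 - \prod_i m i <= \sum_i (1 - m i)].
Proof.
move=> m01; have m0 i : 0 <= m i by case/andP: (m01 i) => /ltW.
have m1 i : m i <= 1 by case/andP: (m01 i).
split.
- by apply: prodr_gt0 => i _; case/andP: (m01 i).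
- by apply: prodr_ile1 => i _; rewrite m0 m1.
- move=> i; rewrite (bigD1 i)//= ler_piMr//.
  by apply: prodr_ile1 => j _; rewrite m0 m1.
- suff [] : 1 - \prod_i m i <= \sum_i (1 - m i) /\ 0 <= \prod_i m i <= 1 by [].
  apply: (big_rec2 (fun p s => 1 - p <= s /\ 0 <= p <= 1)).
    by rewrite subrr !lexx ler01.
  move=> i p s _ [ps /andP[p0 p1]]; have := m0 i; have := m1 i => m1i m0i.
  split; last by rewrite mulr_ge0//= mulr_ile1.
  by have : 0 <= (1 - m i) * (1 - p); [rewrite mulr_ge0 ?subr_ge0|lra].
Qed.

(** Infimum and supremum serve: an interval contains the segment between any two of its points, so
    its measure bounds their distance. An empty interval gets the degenerate hull at 0. *)
Lemma itv_hull (R : realType) (i : interval R) (a b T : R) : 0 <= T ->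
  [set` i] `<=` `[a, b] ->
  (lebesgue_measure [set` i] <= T%:E)%E ->
  exists p q, [/\ p <= q, q - p <= T & forall t, t \in i -> p <= t <= q].
Proof.
move=> T0 iab muT.
have [i0|/set0P[t ti]] := eqVneq [set` i] set0.
  exists 0, 0; split; rewrite ?subrr// => t ti.
  by have : [set` i] t by []; rewrite i0.
have lb : has_lbound [set` i].
  by exists a => r /iab; rewrite /= in_itv/= => /andP[].
have ub : has_ubound [set` i].
  by exists b => r /iab; rewrite /= in_itv/= => /andP[].
have width r s : r \in i -> s \in i -> s - r <= T.
  move=> ri si; have [rs|] := ltP r s; last by lra.
  rewrite -lee_fin; apply: le_trans muT.
  have -> : (s - r)%:E = lebesgue_measure `[r, s]%classic :> \bar R.
    by rewrite lebesgue_measure_itv/= lte_fin rs.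
  apply: le_measure; rewrite ?inE//.
  by move=> z /=; rewrite in_itv/=; exact: (interval_is_interval ri si).
exists (inf [set` i]), (sup [set` i]); split.
- by apply: (@le_trans _ _ t); [exact: ge_inf|exact: ub_le_sup].
- rewrite lerBlDl; apply: ge_sup => [|s si]; first by exists t.
  rewrite -lerBlDr; apply: lb_le_inf => [|r ri]; first by exists t.
  by have := width r s ri si; lra.
- by move=> s si; apply/andP; split; [exact: ge_inf|exact: ub_le_sup].
Qed.

Lemma first_zero (R : realType) (Y : R -> R) (a b : R) : a <= b ->
  (forall t e, a <= t <= b -> 0 < e -> exists2 d, 0 < d &
    forall r, a <= r <= b -> `|r - t| < d -> `|Y r - Y t| < e) ->
  0 < Y a -> Y b <= 0 ->
  exists2 T, a <= T <= b & Y T = 0 /\ forall r, a <= r < T -> 0 < Y r.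
Proof.
move=> ab cY Ya Yb.
pose S := [set t | a <= t <= b /\ forall r, a <= r <= t -> 0 < Y r].
have Sa : S a.
  by split; rewrite ?lexx// => r /le_anti <-.
have Sb : has_ubound S by exists b => t [/andP[]].
have supS : has_sup S by split; [exists a|].
have am : a <= sup S by exact: ub_le_sup.
have mb : sup S <= b by apply: ge_sup; [exists a|move=> t [/andP[]]].
have mab : a <= sup S <= b by rewrite am mb.
have below r : a <= r < sup S -> 0 < Y r.
  move=> /andP[ar rS]; have rS' : 0 < sup S - r by lra.
  have [t [_ St] rt] := sup_adherent rS' supS.
  by apply: St; apply/andP; split; lra.
(* A negative value would spread to points of [S] just before the supremum; a positive one would let
   positivity continue past it, the supremum being less than [b] since [Y b <= 0]. *)
exists (sup S) => //; split=> //; apply/eqP; case: ltgtP => // [Ym|Ym]; exfalso.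
  have Ym' : 0 < - Y (sup S) by lra.
  have [d d0 Yd] := cY _ _ mab Ym'.
  have [t [/andP[at_ tb] St] dt] := sup_adherent d0 supS.
  have tS : t <= sup S by apply: ub_le_sup => //; split=> //; apply/andP.
  have Yt : 0 < Y t by apply: St; rewrite at_ lexx.
  have tab : a <= t <= b by rewrite at_ tb.
  have td : `|t - sup S| < d by rewrite ler0_norm; lra.
  by have := Yd t tab td; rewrite ltr_norml => /andP[_]; lra.
have [d d0 Yd] := cY _ _ mab Ym.
pose q := Num.min b (sup S + d / 2).
have mltb : sup S < b.
  by rewrite lt_neqAle mb andbT; apply/eqP => E; move: Ym; rewrite E; lra.
have mq : sup S < q by rewrite /q lt_min; apply/andP; split; lra.
have qb : q <= b by rewrite /q ge_min lexx.
have qd : q <= sup S + d / 2 by rewrite /q ge_min lexx orbT.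
have : S q.
  split=> [|r /andP[ar rq]]; first by apply/andP; split; lra.
  have [rS|Sr] := ltP r (sup S); first by apply: below; rewrite ar.
  have rab : a <= r <= b by apply/andP; split; lra.
  have rd : `|r - sup S| < d by rewrite ger0_norm; lra.
  by have := Yd r rab rd; rewrite ltr_norml => /andP[+ _]; lra.
by move=> /(ub_le_sup Sb); lra.
Qed.

(** Time reversal: the last time at level [c] is, up to sign, the first zero of [c - Y (- t)]. *)
Lemma last_exit (R : realType) (Y : R -> R) (a b c : R) : a <= b ->
  (forall t e, a <= t <= b -> 0 < e -> exists2 d, 0 < d &
    forall r, a <= r <= b -> `|r - t| < d -> `|Y r - Y t| < e) ->
  c <= Y a -> Y b < c ->
  exists2 s, a <= s <= b & Y s = c /\ forall r, s < r <= b -> Y r < c.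
Proof.
move=> ab cY Ya Yb.
have [||||T Tab [YT TY]] := @first_zero _ (fun t => c - Y (- t)) (- b) (- a).
- by rewrite lerN2.
- move=> t e tab e0; have tab' : a <= - t <= b by lra.
  have [d d0 Yd] := cY _ _ tab' e0; exists d => // r rab rt.
  have -> : c - Y (- r) - (c - Y (- t)) = - (Y (- r) - Y (- t)) by ring.
  rewrite normrN; apply: Yd; first by lra.
  by rewrite -opprD normrN.
- by rewrite opprK subr_gt0.
- by rewrite opprK subr_le0.
exists (- T); first by lra.
split; first by lra.
move=> r /andP[Tr rb]; have := TY (- r); rewrite opprK subr_gt0; apply.
by apply/andP; split; lra.
Qed.

(** * Attack cycles *)

Lemma is_derive_blocks (R : realType) (N : nat) (n_ : 'I_N -> nat)
    (x : R -> 'cV[R]_(\sum_i n_ i)) (t : R) (v : forall i, 'cV[R]_(n_ i)) :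
  (forall i, is_derive t 1 (fun s => submxcol (x s) i) (v i)) ->
  is_derive t 1 x (\mxcol_i v i).
Proof.
move=> xv.
have entryE (k : 'I_(\sum_i n_ i)) : (fun s => x s k 0) =
    fun s => submxcol (x s) (tagnat.sig1 k) (tagnat.sig2 k) 0.
  by apply/funext => s; rewrite mxE tagnat.sig2K.
have dx : derivable x t 1.
  apply/derivable_mxP => k j; rewrite ord1 entryE.
  by have [/derivable_mxP + _] := xv (tagnat.sig1 k); apply.
apply: DeriveDef => //; rewrite derive_mx//.
apply/matrixP => k j; rewrite ord1 !mxE entryE.
have [dxk <-] := xv (tagnat.sig1 k).
by rewrite derive_mx// mxE.
Qed.

(** A product of weights is at most each factor, so one [kappa j] suits all subsystems, and the
    Weierstrass inequality bounds [1 - kappa j] by the sum of the terms [1 - mu i j] that the dual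
    formulas bring into the budget. *)
Lemma budget_weights (R : realType) (N K : nat) (Delta : R)
    (rho : 'I_N -> 'I_K -> R) (T : 'I_N -> R) :
  (0 < K)%N -> 0 < Delta -> (forall i j, rho i j < 0) ->
  (forall i, T i <= theta Delta (rho i) K) ->
  0 <= \sum_(i < N) degradation Delta (rho i) (T i) + K%:R * Delta ->
  exists (lam : 'I_N -> R) (kappa : 'I_K -> R) (kappa0 : R),
    [/\ 0 < kappa0, forall j, kappa0 <= kappa j <= 1, forall i, 0 <= lam i,
      forall i j, kappa j * - rho i j <= lam i &
      \sum_i lam i * T i <= Delta * \sum_j kappa j].
Proof.
move=> K0 Delta0 rho0 Tth budget.
have /choice[lam lamE] : forall i, exists l, 0 < l /\
    - degradation Delta (rho i) (T i) =
      l * T i + Delta * \sum_(j < K) (1 - Num.min 1 (l / - rho i j)).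
  by move=> i; have [l l0 E] := degradation_dual K0 (rho0 i) (Tth i); exists l.
pose mu i j := Num.min 1 (lam i / - rho i j).
have mu01 i j : 0 < mu i j <= 1.
  rewrite /mu lt_min ltr01 ge_min lexx andbT/= divr_gt0 ?oppr_gt0//.
  by case: (lamE i).
pose kappa j := \prod_(i < N) mu i j.
have kappaP j := prod_unit_bounds (mu01^~ j).
have kappa01 j : 0 < kappa j <= 1 by have [-> -> _ _] := kappaP j.
have [k0 _ k0_le _] := prod_unit_bounds kappa01.
(* The product over the layers is just a positive lower bound common to all [kappa j]. *)
exists lam, kappa, (\prod_j kappa j); split=> //.
- by move=> j; rewrite k0_le; case/andP: (kappa01 j).
- by move=> i; apply: ltW; case: (lamE i).
- move=> i j; rewrite -ler_pdivlMr ?oppr_gt0//.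
  have [_ _ /(_ i) le_mu _] := kappaP j; apply: le_trans le_mu _.
  by rewrite /mu ge_min lexx orbT.
have E : - \sum_(i < N) degradation Delta (rho i) (T i) =
    \sum_i lam i * T i + Delta * \sum_j \sum_i (1 - mu i j).
  rewrite -sumrN exchange_big mulr_sumr -big_split/=.
  by apply: eq_bigr => i _; case: (lamE i).
have : \sum_j (1 - kappa j) <= \sum_j \sum_i (1 - mu i j).
  by apply: ler_sum => j _; have [_ _ _] := kappaP j.
rewrite sumrB sumr_const card_ord => H.
have := ler_wpM2l (ltW Delta0) H.
by rewrite mulrBr mulrC -[_ *+ K]/(K%:R); lra.
Qed.

(** Stated for a scalar [y], with a conclusion at [b] that restores the hypothesis at [a], so that
    cycles can be chained. The rate after [m] is a separate clause, as the intervals [[p i, q i]]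
    are not assumed to end before [m]. *)
Lemma attack_cycle_safe (R : realType) (V : normedModType R) (X : R -> V)
    (y : R -> R) (a m b tau c Delta : R) (N K : nat) (rho : 'I_N -> 'I_K -> R)
    (T p q : 'I_N -> R) (E : set R) :
  a <= m -> 0 < tau -> tau <= b - m -> 0 < c ->
  absolutely_continuous_on a b X ->
  (forall t, a <= t <= b -> exists d L, [/\ 0 < d, 0 <= L &
    lipschitz_along X y L (`[a, b] `&` ball t d)]) ->
  (0 < K)%N -> c = K%:R * Delta -> (forall i j, rho i j < 0) ->
  (forall i, T i <= theta Delta (rho i) K) ->
  0 <= \sum_(i < N) degradation Delta (rho i) (T i) + c ->
  (forall i, p i <= q i) -> (forall i, q i - p i <= T i) ->
  (@lebesgue_measure R).-negligible E ->
  (forall t, a <= t <= b -> ~ E t -> 0 <= y t < c ->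
    exists2 D, is_derive t 1 y D &
      (m < t -> c / tau <= D) /\
      forall j : 'I_K, j%:R * Delta <= y t <= j.+1%:R * Delta ->
        c / tau + \sum_(i < N | p i <= t <= q i) rho i j <= D) ->
  c <= y a ->
  (forall t, a <= t <= b -> 0 < y t) /\ c <= y b.
Proof.
move=> am tau0 mb c0 acX y_lip K0 cE rho0 Tth budget pq qpT E0 yE ya.
have w0 : 0 < c / tau by rewrite divr_gt0.
have Delta0 : 0 < Delta by move: c0; rewrite cE pmulr_rgt0// ltr0n.
have y_dist a' b' : a <= a' -> b' <= b -> forall t e, a' <= t <= b' -> 0 < e ->
    exists2 d, 0 < d &
      forall r, a' <= r <= b' -> `|r - t| < d -> `|y r - y t| < e.
  move=> aa bb t e tab e0.
  have tab' : a <= t <= b by lra.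
  have [d d0 yd] := locally_lipschitz_along_dist acX y_lip tab' e0.
  by exists d => // r rab; apply: yd; lra.
have y_lip' a' b' : a <= a' -> b' <= b -> forall t, a' <= t <= b' ->
    exists d L, [/\ 0 < d, 0 <= L &
      lipschitz_along X y L (`[a', b'] `&` ball t d)].
  move=> aa bb t tab.
  have tab' : a <= t <= b by lra.
  have [d [L [d0 L0 yL]]] := y_lip t tab'; exists d, L; split=> //.
  move=> r s /= []; rewrite !in_itv/= => rab rt [sab st].
  by apply: yL; split=> //=; rewrite in_itv/=; lra.
(* The rate is known for [y t < c] and, during recovery, for [m < t]; the starting time [s] may
   violate either, so it is discarded. *)
have E'0 s : (@lebesgue_measure R).-negligible (E `|` [set s]).
  apply: negligibleU => //; apply/negligibleP => //.
  exact: lebesgue_measure_set1.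
(* Otherwise there are a first zero [T0] and, before it, a last time [s] at level [c]; between them
   [y] stays in the margin, where the weighted level estimate applies. *)
have y0 t : a <= t <= b -> 0 < y t.
  move=> tab; rewrite ltNge; apply/negP => yt0.
  have [|||T0 T0at [yT0 T0y]] := @first_zero _ y a t _ _ _ yt0.
  - by lra.
  - by apply: y_dist; lra.
  - by lra.
  have [||||s saT [ys sy]] := @last_exit _ y a T0 c.
  - by lra.
  - by apply: y_dist; lra.
  - by [].
  - by lra.
  have sT0 : s < T0.
    rewrite lt_neqAle; apply/andP; split; last by lra.
    by apply/eqP => sT; move: ys; rewrite sT; lra.
  have y_range r : s <= r <= T0 -> 0 <= y r <= K%:R * Delta.
    move=> srT; rewrite -cE; apply/andP; split.
      have [rT|Tr] := ltP r T0; first by apply/ltW/T0y; lra.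
      by have -> : r = T0; [lra|rewrite yT0].
    have [sr|rs] := ltP s r; first by apply/ltW/sy; lra.
    by have -> : r = s; [lra|rewrite ys].
  have budgetK := budget; rewrite cE in budgetK.
  have [lam [kappa [kappa0 [k0 k01 lam0 klam budget']]]] :=
    budget_weights K0 Delta0 rho0 Tth budgetK.
  have acX' : absolutely_continuous_on s T0 X.
    by apply: absolutely_continuous_on_sub acX; lra.
  have lip' : forall t, s <= t <= T0 -> exists d L, [/\ 0 < d, 0 <= L &
      lipschitz_along X y L (`[s, T0] `&` ball t d)] by apply: y_lip'; lra.
  have yE' t' : s <= t' <= T0 -> ~ (E `|` [set s]) t' ->
      exists2 D, is_derive t' 1 y D &
      forall j : 'I_K, j%:R * Delta <= y t' <= j.+1%:R * Delta ->
        c / tau + \sum_(i < N | p i <= t' <= q i) rho i j <= D.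
    move=> stT nE.
    have st : s != t' by apply/eqP => st; apply: nE; right.
    have {}st : s < t' by rewrite lt_neqAle st; lra.
    have yt' : 0 <= y t' < c.
      have := y_range _ stT; rewrite -cE => /andP[-> _] /=.
      by apply: sy; lra.
    have tab' : a <= t' <= b by lra.
    have [D yD [_ DE]] := yE t' tab' (fun H => nE (or_introl H)) yt'.
    by exists D.
  have := weighted_level_attack (ltW sT0) acX' lip' K0 Delta0 (ltW w0) (ltW k0)
    k01 lam0 klam pq y_range (E'0 s) yE'.
  rewrite ys yT0 weighted_level0// [in weighted_level _ _ _]cE.
  rewrite weighted_level_top// add0r => H.
  have : \sum_i lam i * (q i - p i) <= \sum_i lam i * T i.
    by apply: ler_sum => i _; rewrite ler_wpM2l.
  (* The nominal rate leaves a strict surplus over [[s, T0]], which contradicts the budget. *)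
  have : 0 < kappa0 * (c / tau) * (T0 - s).
    by apply: mulr_gt0; [exact: mulr_gt0|rewrite subr_gt0].
  by move: H budget'; lra.
split=> //; rewrite leNgt; apply/negP => yb.
(* If level [c] is reached after [m], then [s] is the last such time. Otherwise [s] is [m], where
   [y] is positive, and growth at rate [c / tau] for a time at least [tau] gains [c]. *)
have [s [ms sb ys sy]] : exists s, [/\ m <= s, s <= b,
    c <= y s + c / tau * (b - s) & forall r, s < r <= b -> y r < c].
  have [[s [smb ys]]|nys] := pselect (exists s, m <= s <= b /\ c <= y s).
    have [||||s' sab [ys' sy']] := @last_exit _ y s b c.
    - by lra.
    - by apply: y_dist; lra.
    - by [].
    - by [].
    exists s'; split=> //; [lra|lra|].
    by rewrite ys' lerDl; apply: mulr_ge0; [exact: ltW|lra].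
  exists m; split; [lra|lra| |].
    have : c / tau * tau <= c / tau * (b - m) by rewrite ler_wpM2l// ltW.
    by have := y0 m; rewrite divfK ?gt_eqF//; lra.
  move=> r rmb; rewrite ltNge; apply/negP => yr; apply: nys; exists r; lra.
have acX' : absolutely_continuous_on s b X.
  by apply: absolutely_continuous_on_sub acX; lra.
have lip' : forall t, s <= t <= b -> exists d L, [/\ 0 < d, 0 <= L &
    lipschitz_along X y L (`[s, b] `&` ball t d)] by apply: y_lip'; lra.
have := growth_of_derivative sb acX' lip' (w := c / tau) (E'0 s).
suff yE' t : s <= t <= b -> ~ (E `|` [set s]) t ->
    exists2 D, is_derive t 1 y D & c / tau <= D by move=> /(_ yE'); lra.
move=> stb nE.
have st : s != t by apply/eqP => st; apply: nE; right.
have {}st : s < t by rewrite lt_neqAle st; lra.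
have tab : a <= t <= b by lra.
have yt : 0 <= y t < c by rewrite ltW ?y0//=; apply: sy; lra.
have [D yD [Dw _]] := yE t tab (fun H => nE (or_introl H)) yt.
by exists D => //; apply: Dw; lra.
Qed.

Theorem theorem4 (R : realType) (N : nat) (n_ r_ : 'I_N -> nat)
  (f : forall i, 'cV[R]_(\sum_i n_ i) -> 'cV[R]_(n_ i))
  (g : forall i, 'cV[R]_(\sum_i n_ i) -> 'M[R]_(n_ i, r_ i))
  (f_lip : forall i, lipschitz (f i))
  (g_lip : forall i, lipschitz (g i))
  (lo hi : forall i, 'cV[R]_(r_ i))
  (lo_lt_hi : forall i j, lo i j 0 < hi i j 0)
  (uhat : forall i, 'cV[R]_(\sum_i n_ i) -> 'cV[R]_(r_ i))
  (uhat_box : forall i x, input_box (lo i) (hi i) (uhat i x))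
  (h : 'cV[R]_(\sum_i n_ i) -> R)
  (h_C1 : continuously_differentiable h)
  (c : R) (c_gt0 : 0 < c)
  (alpha : R -> R) (alpha_K : extended_class_K alpha)
  (tau : R) (tau_gt0 : 0 < tau)
  (nominal : nominal_policy_assumption h f g uhat alpha c tau)
  (A : finType) (trec : A -> R) (trec_ge0 : forall a, 0 <= trec a)
  (M : 'I_N -> A)
  (K : nat) (K_gt0 : (0 < K)%N)
  (rho : 'I_N -> 'I_K -> R) (rho_lt0 : forall i j, rho i j < 0)
  (rho_bound : forall i (j : 'I_K) x v,
    layer h (c / K%:R) j x -> input_box (lo i) (hi i) v ->
    rho i j <= (block_grad h i x *m g i x *m (v - uhat i x)) 0 0)
  (trec_dom : forall i,
    degradation_domain (c / K%:R) (rho i) (trec (M i)))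
  (budget :
    0 <= (\sum_(i < N) degradation (c / K%:R) (rho i) (trec (M i))) + c)
  (t0 : R) (ts tf : nat -> R)
  (cycles : attack_cycles t0 tau ts tf)
  (comp : nat -> 'I_N -> interval R)
  (comp_bound : compromise_intervals (fun i => trec (M i)) ts tf comp)
  (u : forall i, R -> 'cV[R]_(r_ i))
  (u_adm : admissible_input lo hi t0 u)
  (x : R -> 'cV[R]_(\sum_i n_ i))
  (x_traj : trajectory f g u t0 x)
  (u_nominal : nominal_unless_compromised uhat t0 comp u x)
  (x_t0 : superlevel h c (x t0)) :
  forall t, t0 <= t -> superlevel h 0 (x t).
Proof.
have [ts0 ts_tf tf_ts] := cycles.
have [x_ac x_der] := x_traj.
have Kr : K%:R != 0 :> R by rewrite pnatr_eq0 -lt0n.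
have cE : c = K%:R * (c / K%:R) by field.
have ts_step k : ts k + tau <= ts k.+1 by have := ts_tf k; have := tf_ts k; lra.
have ts_mono : {homo ts : j k / (j <= k)%N >-> j <= k}.
  by apply: homo_leq => // [? ? ?|k]; [exact: le_trans|have := ts_step k; lra].
have t0_ts k : t0 <= ts k by rewrite -ts0 ts_mono.
have Tth i : trec (M i) <= theta (c / K%:R) (rho i) K.
  have := trec_dom i; rewrite /degradation_domain; case: eqP => _;
    rewrite /= in_itv/= => /andP[_ H]; [exact: H|exact: ltW].
have /choice[p /choice[q pqP]] : forall k, exists p, exists q, forall i,
    [/\ p i <= q i, q i - p i <= trec (M i) &
      forall t, t \in comp k i -> p i <= t <= q i].
  move=> k; have /choice[p /choice[q pqP]] : forall i, exists p, exists q,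
      [/\ p <= q, q - p <= trec (M i) &
        forall t, t \in comp k i -> p <= t <= q].
    by move=> i; have [sub mu] := comp_bound k i;
      exact: itv_hull (trec_ge0 _) sub mu.
  by exists p, q.
(* There are finitely many subsystems, so one null set serves them all. *)
have x_ae : {ae @lebesgue_measure R, forall t, forall i, t0 <= t ->
    is_derive t 1 (fun s => submxcol (x s) i) (f i (x t) + g i (x t) *m u i t)}.
  exact: (@filter_forall _ _ (fun i t => t0 <= t ->
    is_derive t 1 (fun s => submxcol (x s) i)
      (f i (x t) + g i (x t) *m u i t))
    _ (ae_filter_ringOfSetsType (@lebesgue_measure R)) x_der).
have cycle k : c <= h (x (ts k)) ->
    (forall t, ts k <= t <= ts k.+1 -> 0 < h (x t)) /\ c <= h (x (ts k.+1)).
  have acx : absolutely_continuous_on (ts k) (ts k.+1) x.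
    by apply: absolutely_continuous_on_sub (x_ac (ts k.+1) (t0_ts _)).
  (* The time [ts k.+1] joins the exceptional set because attacks of the next cycle may already act
     there. *)
  apply: (@attack_cycle_safe _ _ x (h \o x) _ (tf k) _ tau c (c / K%:R) N K rho
    (fun i => trec (M i)) (p k) (q k)
    (~` [set t | forall i, t0 <= t -> is_derive t 1 (fun s => submxcol (x s) i)
      (f i (x t) + g i (x t) *m u i t)] `|` [set ts k.+1])) => //.
  - by move=> t; exact: C1_lipschitz_along.
  - by move=> i; have [] := pqP k i.
  - by move=> i; have [] := pqP k i.
  - apply: negligibleU => //; apply/negligibleP => //.
    exact: lebesgue_measure_set1.
  move=> t /andP[tst tts] nE yt.
  have {}tts : t < ts k.+1.
    by rewrite lt_neqAle tts andbT; apply/eqP => tE; apply: nE; right.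
  have t0t : t0 <= t by exact: le_trans tst.
  have dxt i : is_derive t 1 (fun s => submxcol (x s) i)
      (f i (x t) + g i (x t) *m u i t).
    by apply: contrapT => nd; apply: nE; left => /(_ i t0t).
  (* Earlier cycles end before [ts k] because the pause is at least [tau > 0], and later ones have
     not started yet. *)
  have only_k k' i : t \in comp k' i -> k' = k.
    move=> tc; have [sub _] := comp_bound k' i.
    have := sub t tc; rewrite /= in_itv/= => /andP[st tf'].
    apply/eqP; rewrite eqn_leq; apply/andP; split; rewrite leqNgt; apply/negP.
      by move=> /ts_mono; lra.
    by move=> /ts_mono; have := tf_ts k'; lra.
  have nominal_ge : c / tau <= nominal_hdot h f g uhat (x t).
    case: nominal => _; apply; case/andP: yt => y0 yc; split => //=.
    by apply/negP; rewrite -ltNge.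
  pose attack i :=
    (block_grad h i (x t) *m g i (x t) *m (u i t - uhat i (x t))) 0 0.
  have attack0 i : t \notin comp k i -> attack i = 0.
    move=> ti; rewrite /attack (u_nominal i t)// ?subrr ?mulmx0 ?mxE// => k'.
    by apply: contra ti => tk'; rewrite -(only_k _ _ tk').
  exists ('d h (x t) (\mxcol_i (f i (x t) + g i (x t) *m u i t))).
    by apply: is_derive_diff_comp; [exact: is_derive_blocks|case: h_C1].
  have -> : 'd h (x t) (\mxcol_i (f i (x t) + g i (x t) *m u i t)) =
      nominal_hdot h f g uhat (x t) + \sum_i attack i.
    rewrite diff_block_grad; last by case: h_C1.
    rewrite /nominal_hdot -big_split/=; apply: eq_bigr => i _.
    rewrite mxcolK /attack mulmxBr mulmxDr mulmxDr !mulmxA !mxE.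
    by lra.
  split.
    move=> tf_t; rewrite big1 ?addr0// => i _; apply: attack0.
    apply/negP => tc; have [sub _] := comp_bound k i.
    by have := sub t tc; rewrite /= in_itv/=; lra.
  move=> j yj; apply: lerD => //.
  (* Inside the hull [rho_bound] applies to whatever admissible input is in force; outside it the
     subsystem is not compromised and its deviation vanishes. *)
  rewrite [leRHS](bigID (fun i => p k i <= t <= q k i))/=.
  rewrite -[leLHS]addr0; apply: lerD.
    apply: ler_sum => i _; apply: rho_bound => //.
    by case: u_adm => _; apply.
  rewrite big1// => i ti; apply: attack0; apply: contra ti.
  by have [_ _] := pqP k i; apply.
have safe_start k : c <= h (x (ts k)).
  by elim: k => [|k /cycle[]//]; rewrite ts0.
move=> t t0t.
(* Consecutive cycles start at least [tau] apart, so their starts exceed any given time. *)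
have [k tk] : exists k, t < ts k.+1.
  have ts_ge k : t0 + k%:R * tau <= ts k.
    elim: k => [|k IH]; first by rewrite mul0r addr0 ts0.
    by have := ts_step k; rewrite -natr1 mulrDl mul1r; lra.
  have := archi_boundP (normr_ge0 ((t - t0) / tau)).
  set n := Num.bound _ => tn; exists n.
  have : t - t0 < n%:R * tau.
    by rewrite -ltr_pdivrMr//; apply: le_lt_trans tn; exact: ler_norm.
  by have := ts_ge n; have := ts_step n; lra.
have exk : exists k, t < ts k.+1 by exists k.
(* Minimality of [l] yields [ts l <= t]; for [l = 0] this is [t0 <= t]. *)
have [l tl lmin] := ex_minnP exk.
suff tsl : ts l <= t.
  have [pos _] := cycle l (safe_start l).
  by apply: ltW; apply: pos; rewrite tsl ltW.
case: l tl lmin => [|l] tl lmin; first by rewrite ts0.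
by rewrite leNgt; apply/negP => /lmin; rewrite ltnn.
Qed.
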